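(* Let $k\ge 1$, $n\ge 2$, $\mathbf C=(c_0,\dots,c_k)\in\{0,1\}^{k+1}$, and $\gamma$ Euler's constant. Put $\lambda=c_0(n-1)+c_1k(\log(n-1)+\gamma)+\frac{\pi^2}{6}\sum_{\beta=2}^kc_\beta\binom{k}{\beta}$ and $\lambda'=c'_0(n-1)+c'_1k(\log(n-1)+\gamma)+\frac{\pi^2}{6}\sum_{\beta=2}^kc'_\beta\binom{k}{\beta}$. Then: (i) for $0\le m\le n$, $O_{\mathbf C}(n,m)\le O_{\mathbf C'\max}(n,n-m)$; (ii) $\dfrac{\sum_{m=0}^nO_{\mathbf C\max}(n,m)}{\sum_{m=0}^nO_{\mathbf C}(n,m)}\le\exp(\lambda)$; (iii) $\dfrac{\sum_{m=0}^nO_{\mathbf C'\max}(n,m)}{\sum_{m=0}^nO_{\mathbf C}(n,m)}\le\exp(\lambda')$; (iv) for $k=1$, $\mathbf C=(0,1)$, with $s_u(n,m)$ the unsigned Stirling numbers of the first kind and $s_{u\max}(n,m)=\frac{(n-1)!}{(m-1)!}\left(\sum_{i=1}^{n-1}\frac1i\right)^{m-1}$ for $1\le m\le n$ (and $0$ for $m=0$), $$\frac{\sum_{m=0}^ns_{u\max}(n,m)}{\sum_{m=0}^ns_u(n,m)}\le\frac{n-1}{n}\exp\Big(\sum_{j=2}^n\frac1{j-1}-\log(n-1)\Big)\le\exp(\gamma)\le 1.7811.$$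
   Context: Fix integers $k\ge 1$, $n\ge 2$ and $\mathbf C=(c_0,\dots,c_k)\in\{0,1\}^{k+1}$; put $\mathbf C'=(1,\dots,1)-\mathbf C=(c'_0,\dots,c'_k)$. Consider $k$-tuples $(\pi_1,\dots,\pi_k)$ of permutations of $\{1,\dots,n\}$. A position $\alpha$ is a record of a permutation $\pi$ if $\pi(\alpha)<\pi(\alpha')$ for every $\alpha'<\alpha$ (position $1$ is always a record). For a tuple, let $l_\alpha$ be the number of $\beta\in\{1,\dots,k\}$ for which $\alpha$ is a record of $\pi_\beta$. The $\mathbf C$ sequential optimization set is $S=\{\alpha:c_{l_\alpha}=1\}$, with weight $|S|$; $O_{\mathbf C}(n,m)$ is the number of $k$-tuples of weight $m$ (for integer $m$), and $O_{\mathbf C'}$ is the same with $\mathbf C'$. For $j\ge2$ and $X\in\mathbb R^{k+1}$, $F_j(X)=\sum_{\beta=0}^k\binom{k}{\beta}\frac{x_\beta}{(j-1)^\beta}$. Let $\mathbf H_n\mathbf X^T=\sum_{\beta=0}^k x_\beta\binom{k}{\beta}\sum_{j=1}^{n-1}j^{-\beta}$. For $1\le m\le n$, $O_{\mathbf C\max}(n,m+c_k-1)=\frac{(n-1)!^k}{(m-1)!}(\mathbf H_n\mathbf C^T)^{m-1}\prod_{i=1}^{n-m}F_{i+1}(\mathbf C')$ and $O_{\mathbf C'\max}(n,m+c'_k-1)=\frac{(n-1)!^k}{(m-1)!}(\mathbf H_n\mathbf C'^T)^{m-1}\prod_{i=1}^{n-m}F_{i+1}(\mathbf C)$; at integer arguments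 outside these ranges $O_{\mathbf C\max}$ and $O_{\mathbf C'\max}$ are taken to be $0$. Empty products equal $1$; $\log$ is the natural logarithm. *)

(* Defs.v *)
From HB Require Import structures.
From mathcomp Require Import all_boot all_order all_algebra all_fingroup.
From mathcomp Require Import all_classical all_reals all_analysis.
Set Implicit Arguments. Unset Strict Implicit. Unset Printing Implicit Defensive.
Import Order.TTheory GRing.Theory Num.Theory.
Local Open Scope ring_scope.

(* Positions {1..n} are encoded as 'I_n = {0..n-1}; k-tuples of permutations
   of {1..n} as finite functions 'I_k -> {perm 'I_n}.
   C = (c_0,...,c_k) is a function 'I_k.+1 -> bool. *)

Definition ktuple (k n : nat) := {ffun 'I_k -> {perm 'I_n}}.

Definition is_record (n : nat) (p : {perm 'I_n}) (a : 'I_n) : bool :=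
  [forall a' : 'I_n, (a' < a)%N ==> (p a < p a')%N].

Definition lcount (k n : nat) (t : ktuple k n) (a : 'I_n) : nat :=
  #|[set b : 'I_k | is_record (t b) a]|.

(* the C sequential optimization set S = {alpha : c_{l_alpha} = 1}
   (l_alpha <= k, so inord is the identity on its value) *)
Definition opt_set (k n : nat) (C : 'I_k.+1 -> bool) (t : ktuple k n)
  : {set 'I_n} := [set a : 'I_n | C (inord (lcount t a))].

Definition weight (k n : nat) (C : 'I_k.+1 -> bool) (t : ktuple k n) : nat :=
  #|opt_set C t|.

Definition OC (k n : nat) (C : 'I_k.+1 -> bool) (m : nat) : nat :=
  #|[set t : ktuple k n | weight C t == m]|.

Definition compl (k : nat) (C : 'I_k.+1 -> bool) : 'I_k.+1 -> bool :=
  fun i => ~~ C i.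

Definition vecR (R : realType) (k : nat) (C : 'I_k.+1 -> bool) : 'I_k.+1 -> R :=
  fun i => (C i : nat)%:R.

Definition HnX (R : realType) (k n : nat) (X : 'I_k.+1 -> R) : R :=
  \sum_(b < k.+1) X b * 'C(k, b)%:R * \sum_(1 <= j < n) (j%:R ^- b).

Definition Fj (R : realType) (k j : nat) (X : 'I_k.+1 -> R) : R :=
  \sum_(b < k.+1) 'C(k, b)%:R * X b / ((j.-1)%:R ^+ b).

(* O_{C max}(n, a): for a = m + c_k - 1 with 1 <= m <= n, i.e. m = a + 1 - c_k,
   the formula; 0 otherwise.  (Only nonnegative arguments a are ever used;
   negative integer arguments give 0 by convention.)  O_{C' max} is
   OCmax (compl C). *)
Definition OCmax (R : realType) (k n : nat) (C : 'I_k.+1 -> bool) (a : nat) : R :=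
  let m := (a.+1 - C ord_max)%N in
  if (1 <= m <= n)%N then
    ((n.-1)`!)%:R ^+ k / ((m.-1)`!)%:R * (HnX n (vecR R C)) ^+ m.-1
      * \prod_(1 <= i < (n - m).+1) Fj i.+1 (vecR R (compl C))
  else 0.

Definition euler_gamma (R : realType) : R :=
  limn (fun N : nat => \sum_(1 <= j < N.+1) (j%:R : R)^-1 - ln (N%:R : R)).

Fixpoint stirling1u (n m : nat) : nat :=
  match n, m with
  | 0, 0 => 1
  | 0, _.+1 => 0
  | _.+1, 0 => 0
  | n'.+1, m'.+1 => n' * stirling1u n' m'.+1 + stirling1u n' m'
  end.

Definition sumax (R : realType) (n m : nat) : R :=
  if (1 <= m <= n)%N then
    ((n.-1)`!)%:R / ((m.-1)`!)%:R * (\sum_(1 <= i < n) (i%:R : R)^-1) ^+ m.-1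
  else 0.

Definition lambdaC (R : realType) (k n : nat) (C : 'I_k.+1 -> bool) : R :=
  vecR R C (inord 0) * (n.-1)%:R
  + vecR R C (inord 1) * k%:R * (ln ((n.-1)%:R : R) + euler_gamma R)
  + pi ^+ 2 / 6%:R * \sum_(2 <= b < k.+1) vecR R C (inord b) * 'C(k, b)%:R.

(* Main.v *)
Require Import Defs.
From HB Require Import structures.
From mathcomp Require Import all_boot all_order all_algebra all_fingroup.
From mathcomp Require Import all_classical all_reals all_analysis.
From mathcomp Require Import ring lra zify.
Import Order.TTheory GRing.Theory Num.Theory.
Import numFieldNormedType.Exports.
Local Open Scope ring_scope.
Set Implicit Arguments.
Unset Strict Implicit.
Unset Printing Implicit Defensive.

(** Appending a position to each permutation of a tuple multiplies the weight
    enumerator [\sum_t X^(weight t)] by n^k (F_(n+1)(C') + F_(n+1)(C) X), so for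
    tuples of permutations of n points it is
    (n-1)!^k X^(c_k) \prod_(j = 2)^n (F_j(C') + F_j(C) X).
    Since F_j decreases in j, the coefficient of X^q in the product is at most
    (H_n C^T)^q / q! times the product of the n-1-q largest F_j(C'), that is,
    O <= O_max; part (i) is this bound for C', as complementing C turns weight m
    into weight n - m.

    For (ii) and (iii), H_n C^T itself can exceed lambda, because the harmonic
    number h_N exceeds log N + gamma.  But h_N <= (1 + 1/N)(log N + gamma) with
    N = n - 1, hence H_n C^T <= (n/(n-1)) lambda; and the product of the first
    n-1-q values of F is at most (n-q)^k.  As (n/(n-1))^q (n-q) <= n, the q-th
    summand of the numerator is at most n!^k lambda^q / q!, and these sum to at
    most n!^k exp lambda. *)

(** * The weight enumerator *)

Section LastPosition.
Variable n : nat.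
Implicit Type p : {perm 'I_n.+1}.

Lemma is_record_ord_max p : is_record p ord_max = (p ord_max == ord0).
Proof.
apply/forallP/eqP => [max_rec|p_max a].
  pose a := (p^-1)%g ord0; have pa : p a = ord0 by rewrite permKV.
  case: (unliftP ord_max a) => [b ab|<- //].
  by have /implyP := max_rec a; rewrite pa ab lift_max ltn0 ltn_ord => /(_ isT).
apply/implyP; rewrite p_max lt0n => lt_a_max.
apply: contraTneq lt_a_max => pa.
have /perm_inj -> : p a = p ord_max by rewrite p_max; apply: val_inj.
by rewrite ltnn.
Qed.

Lemma is_record_lift_perm (j : 'I_n.+1) (s : {perm 'I_n}) (a : 'I_n) :
  is_record (lift_perm ord_max j s) (lift ord_max a) = is_record s a.
Proof.
apply/forallP/forallP => a_rec b; apply/implyP.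
  move: (a_rec (lift ord_max b)); rewrite !lift_max !lift_perm_lift /= /bump.
  by move=> /implyP imp /imp; lia.
case: (unliftP ord_max b) => [c ->|->]; last by rewrite lift_max ltnNge ltnW.
rewrite !lift_max !lift_perm_lift /= /bump.
by move: (a_rec c) => /implyP imp /imp; lia.
Qed.

End LastPosition.

Lemma card_ktuple (k n : nat) : #|{: ktuple k n}| = (n`! ^ k)%N.
Proof. by rewrite card_ffun card_ord card_Sn. Qed.

Lemma weight_sum (k n : nat) (C : 'I_k.+1 -> bool) (t : ktuple k n) :
  weight C t = (\sum_(a < n) C (inord (lcount t a)))%N.
Proof.
rewrite /weight -sum1_card big_mkcond /=; apply: eq_bigr => a _.
by rewrite inE; case: (C _).
Qed.

(* Deleting the last position of each permutation and standardizing inverts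
   [extend_tuple]. *)
Definition extend_tuple (k n : nat) (ft : {ffun 'I_k -> 'I_n.+1} * ktuple k n) :
  ktuple k n.+1 := [ffun b => lift_perm ord_max (ft.1 b) (ft.2 b)].

Definition zero_set (k n : nat) (f : {ffun 'I_k -> 'I_n.+1}) : {set 'I_k} :=
  [set b | f b == ord0].

Section Extension.
Variables k n : nat.
Implicit Types (C : 'I_k.+1 -> bool) (f : {ffun 'I_k -> 'I_n.+1}).
Implicit Type t : ktuple k n.

Lemma extend_tuple_bij : bijective (@extend_tuple k n).
Proof.
apply: inj_card_bij => [[f t] [g u] /ffunP /= eq_fg|]; last first.
  by rewrite card_prod !card_ktuple card_ffun !card_ord factS expnMn.
have eq_last b : f b = g b.
  have := eq_fg b; rewrite !ffunE => /permP/(_ ord_max).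
  by rewrite !lift_perm_id.
congr pair; apply/ffunP => b //; apply/permP => a.
have := eq_fg b; rewrite !ffunE /= eq_last => /permP/(_ (lift ord_max a)).
by rewrite !lift_perm_lift => /lift_inj.
Qed.

Lemma lcount_extend_lift f t (a : 'I_n) :
  lcount (extend_tuple (f, t)) (lift ord_max a) = lcount t a.
Proof. by apply: eq_card => b; rewrite !inE ffunE is_record_lift_perm. Qed.

Lemma lcount_extend_max f t :
  lcount (extend_tuple (f, t)) ord_max = #|zero_set f|.
Proof.
by apply: eq_card => b; rewrite !inE ffunE is_record_ord_max lift_perm_id.
Qed.

Lemma weight_extend C f t :
  weight C (extend_tuple (f, t)) = (weight C t + C (inord #|zero_set f|))%N.
Proof.
rewrite !weight_sum big_ord_recr /= lcount_extend_max; congr addn.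
apply: eq_bigr => a _; rewrite -(lcount_extend_lift f).
congr (nat_of_bool (C (inord (lcount _ _)))).
by apply: val_inj; exact/esym/lift_max.
Qed.

Lemma card_zero_set (B : {set 'I_k}) :
  #|[set f : {ffun 'I_k -> 'I_n.+1} | zero_set f == B]| = (n ^ (k - #|B|))%N.
Proof.
pose F (b : 'I_k) : pred 'I_n.+1 := if b \in B then pred1 ord0 else predC1 ord0.
transitivity #|family F|.
  apply: eq_card => f; rewrite !inE; apply/eqP/familyP => [fB b|fB].
    by rewrite /F -fB inE; case: ifP => fb; rewrite inE /= fb.
  apply/setP => b; have := fB b; rewrite /F inE.
  by case: ifP => _; rewrite inE => // /negPf.
rewrite card_family foldrE big_image /=.
rewrite (bigID (mem B)) /= big1 => [|b bB]; last by rewrite /F bB card1.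
rewrite mul1n (eq_bigr (fun=> n)) => [|b /negPf bB]; last first.
  by rewrite /F bB cardC1 card_ord.
by rewrite prod_nat_const -[k in (k - _)%N]card_ord -(cardC (mem B)) addKn.
Qed.

Lemma sum_card_zero_set (V : nmodType) (G : nat -> V) :
  \sum_(f : {ffun 'I_k -> 'I_n.+1}) G #|zero_set f|
  = \sum_(b < k.+1) G b *+ ('C(k, b) * n ^ (k - b)).
Proof.
rewrite (partition_big (@zero_set k n) predT) //=.
rewrite (eq_bigr (fun B : {set 'I_k} => G #|B| *+ n ^ (k - #|B|))); last first.
  move=> B _; rewrite (eq_bigr (fun=> G #|B|)) => [|f /eqP <- //].
  by rewrite sumr_const -card_zero_set cardsE.
rewrite (partition_big (fun B : {set 'I_k} => inord #|B| : 'I_k.+1) predT) //=.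
apply: eq_bigr => b _.
have card_inord (B : {set 'I_k}) : (inord #|B| == b) = (#|B| == b :> nat).
  by rewrite -val_eqE /= inordK // ltnS -[X in (_ <= X)%N]card_ord max_card.
under eq_bigl do rewrite card_inord.
rewrite (eq_bigr (fun=> G b *+ n ^ (k - b))) => [|B /eqP -> //].
by rewrite sumr_const -mulrnA mulnC -[k in 'C(k, _)]card_ord -card_draws cardsE.
Qed.

End Extension.

Section WeightEnumerator.
Variables (R : comNzRingType) (k : nat) (C : 'I_k.+1 -> bool).

Definition weight_poly (n : nat) : {poly R} :=
  \sum_(t : ktuple k n) 'X^(weight C t).

(* The factor contributed by appending position [n + 1]: it is a record of
   exactly [b] of the [k] permutations in ['C(k, b) * n ^ (k - b)] ways. *)
Definition record_poly (n : nat) : {poly R} :=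
  \sum_(b < k.+1) 'X^(C b) *+ ('C(k, b) * n ^ (k - b)).

Lemma coef_weight_poly (n m : nat) : (weight_poly n)`_m = (OC n C m)%:R.
Proof.
rewrite /OC -sum1_card natr_sum coef_sum [RHS]big_mkcond; apply: eq_bigr => t _.
by rewrite coefXn inE eq_sym; case: eqP.
Qed.

Lemma weight_poly0 : weight_poly 0 = 1.
Proof.
rewrite /weight_poly (eq_bigr (fun=> 1)) => [|t _]; last first.
  by rewrite weight_sum big_ord0 expr0.
by rewrite sumr_const card_ktuple fact0 exp1n.
Qed.

Lemma weight_polyS (n : nat) :
  weight_poly n.+1 = weight_poly n * record_poly n.
Proof.
have [g extendK gK] := extend_tuple_bij k n.
rewrite /weight_poly (reindex (@extend_tuple k n)) /=; last by exists g => ? _.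
rewrite -(pair_bigA _ (fun f t => 'X^(weight C (extend_tuple (f, t))))).
rewrite exchange_big.
under eq_bigr do under eq_bigr do rewrite weight_extend exprD.
under eq_bigr do
  rewrite -mulr_sumr (sum_card_zero_set k n (fun l => 'X^(C (inord l)))).
rewrite -mulr_suml; congr (_ * _); apply: eq_bigr => b _.
by rewrite inord_val.
Qed.

Lemma weight_polyE (n : nat) :
  weight_poly n = \prod_(0 <= j < n) record_poly j.
Proof.
elim: n => [|n IH]; first by rewrite big_geq // weight_poly0.
by rewrite big_nat_recr //= -IH weight_polyS.
Qed.

Lemma record_poly0 : record_poly 0 = 'X^(C ord_max).
Proof.
rewrite /record_poly big_ord_recr /= big1 => [|b _]; last first.
  by rewrite exp0n ?muln0 // subn_gt0.
by rewrite add0r binn subnn.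
Qed.

End WeightEnumerator.

Section WeightCounts.
Variables (k n : nat) (C : 'I_k.+1 -> bool).

Lemma weight_le (t : ktuple k n) : (weight C t <= n)%N.
Proof. by rewrite -[X in (_ <= X)%N]card_ord max_card. Qed.

Lemma OC_compl (m : nat) : (m <= n)%N -> OC n C m = OC n (compl C) (n - m).
Proof.
move=> le_mn; apply: eq_card => t; rewrite !inE.
have opt_setC : opt_set (compl C) t = ~: opt_set C t.
  by apply/setP => a; rewrite !inE.
have := cardsC (opt_set C t); rewrite -opt_setC card_ord /weight => card_sum.
by apply/eqP/eqP; lia.
Qed.

Lemma sum_OC : (\sum_(0 <= m < n.+1) OC n C m = n`! ^ k)%N.
Proof.
rewrite -card_ktuple big_mkord -sum1_card.
pose bounded_weight (t : ktuple k n) : 'I_n.+1 := inord (weight C t).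
rewrite (partition_big bounded_weight predT) //=.
apply: eq_bigr => m _; rewrite sum1_card /OC; apply: eq_card => t.
by rewrite !inE unfold_in /= inordK // ltnS weight_le.
Qed.

End WeightCounts.

(** * Coefficients of a product of linear factors *)

Lemma exprD_ge_first_order (R : numDomainType) (x y : R) (q : nat) :
  0 <= x -> 0 <= y ->
  x ^+ q.+1 + q.+1%:R * (y * x ^+ q) <= (x + y) ^+ q.+1.
Proof.
move=> x0 y0; rewrite exprDn 2!big_ord_recl /= subn0 subn1 bin0 bin1.
rewrite expr0 expr1 mulr1 mulr1n [y * _]mulrC mulr_natl addrA lerDl.
rewrite sumr_ge0 // => i _.
by apply: mulrn_wge0; apply: mulr_ge0; exact: exprn_ge0.
Qed.

Lemma size_prod_linear_leq (R : nzRingType) (a b : nat -> R) (N : nat) :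
  (size (\prod_(0 <= j < N) ((b j)%:P + a j *: 'X))%R <= N.+1)%N.
Proof.
have size_linear j : (size ((b j)%:P + a j *: 'X)%R <= 2)%N.
  rewrite addrC -mul_polyC size_MXaddC.
  by case: ifP => // _; rewrite ltnS size_polyC_leq1.
elim: N => [|N IH]; first by rewrite big_geq // size_poly1.
rewrite big_nat_recr //=; apply: leq_trans (size_polyMleq _ _) _.
by have := leq_add IH (size_linear N); rewrite addn2; case: (_ + _)%N.
Qed.

Section ProdLinear.
Variables (R : numFieldType) (a b : nat -> R).

(* The [q]-th coefficient of [\prod_(j < N) (b_j + a_j 'X)] sums, over the
   [q]-subsets of [0, N), products of [q] values of [a] and [N - q] values of
   [b]; the latter are at most the [N - q] largest ones. *)
Definition prod_linear_bound (N q : nat) : R :=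
  (\sum_(0 <= j < N) a j) ^+ q / q`!%:R * \prod_(0 <= j < N - q) b j.

Hypotheses (a_ge0 : forall j, 0 <= a j) (b_ge0 : forall j, 0 <= b j).

Lemma prod_linear_bound_ge0 (N q : nat) : 0 <= prod_linear_bound N q.
Proof.
apply: mulr_ge0; last exact: prodr_ge0.
by rewrite divr_ge0 ?exprn_ge0 ?sumr_ge0.
Qed.

Hypothesis b_nonincr : {homo b : i j / (i <= j)%N >-> j <= i}.

Lemma mul_prod_nonincr_le (N q : nat) : (q <= N)%N ->
  b N * \prod_(0 <= j < N - q) b j <= \prod_(0 <= j < N.+1 - q) b j.
Proof.
move=> qN; rewrite subSn // big_nat_recr //= mulrC ler_wpM2l ?prodr_ge0 //.
by rewrite b_nonincr // leq_subr.
Qed.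

Lemma coef_prod_linear_le (N q : nat) :
  (\prod_(0 <= j < N) ((b j)%:P + a j *: 'X))`_q <= prod_linear_bound N q.
Proof.
elim: N q => [|N IH] q.
  rewrite big_geq // coef1; case: q => [|q]; last exact: prod_linear_bound_ge0.
  by rewrite /prod_linear_bound expr0 fact0 !big_geq // divr1 mulr1.
rewrite big_nat_recr //= mulrDr -scalerAr coefD coefMC coefZ coefMX.
case: q => [|q] /=.
  rewrite mulr0 addr0; apply: le_trans (ler_wpM2r (b_ge0 N) (IH 0%N)) _.
  rewrite /prod_linear_bound !expr0 fact0 divr1 !mul1r mulrC.
  exact: mul_prod_nonincr_le.
set A := \sum_(0 <= j < N) a j; set P := \prod_(0 <= j < N.+1 - q.+1) b j.
have A0 : 0 <= A by exact: sumr_ge0.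
have P0 : 0 <= P by exact: prodr_ge0.
have low_le : (\prod_(0 <= j < N) ((b j)%:P + a j *: 'X))`_q.+1 * b N
    <= A ^+ q.+1 / q.+1`!%:R * P.
  have [qN|Nq] := ltnP q N; last first.
    rewrite nth_default ?mul0r ?mulr_ge0 ?divr_ge0 ?exprn_ge0 //.
    by apply: leq_trans (size_prod_linear_leq _ _ N) _.
  apply: le_trans (ler_wpM2r (b_ge0 N) (IH q.+1)) _.
  rewrite /prod_linear_bound -[leLHS]mulrA.
  rewrite ler_wpM2l ?divr_ge0 ?exprn_ge0 // mulrC.
  exact: mul_prod_nonincr_le.
apply: le_trans (lerD low_le (ler_wpM2l (a_ge0 N) (IH q))) _.
rewrite /prod_linear_bound big_nat_recr //= -/A -[(N - q)%N]subSS -/P.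
rewrite [leLHS](_ : _ =
    (A ^+ q.+1 + q.+1%:R * (a N * A ^+ q)) / q.+1`!%:R * P); last first.
  rewrite factS natrM; field.
  by rewrite nat1r !pnatr_eq0 -lt0n fact_gt0.
by rewrite ler_wpM2r ?ler_wpM2r ?invr_ge0 ?exprD_ge_first_order.
Qed.

End ProdLinear.

(** * The closed form [OCmax] *)

Section RecordRates.
Variables (R : realType) (k : nat).
Implicit Types (C : 'I_k.+1 -> bool) (X : 'I_k.+1 -> R).

Lemma vecR_bounds C b : 0 <= vecR R C b <= 1.
Proof. by rewrite /vecR; case: (C b); rewrite lexx ler01. Qed.

Lemma vecR_ge0 C b : 0 <= vecR R C b.
Proof. by case/andP: (vecR_bounds C b). Qed.

(* The values F_2(X), F_3(X), ... indexed from [0]. *)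
Definition Fseq X (j : nat) : R := Fj j.+2 X.

Lemma HnX_sum (n : nat) X : HnX n.+1 X = \sum_(0 <= j < n) Fseq X j.
Proof.
rewrite /HnX /Fseq /Fj exchange_big /=; apply: eq_bigr => b _.
by rewrite big_add1 mulr_sumr; apply: eq_bigr => j _; rewrite [X b * _]mulrC.
Qed.

Lemma Fseq_ge0 X (j : nat) : (forall b, 0 <= X b) -> 0 <= Fseq X j.
Proof.
by move=> X0; apply: sumr_ge0 => b _; rewrite divr_ge0 ?exprn_ge0 ?mulr_ge0.
Qed.

Lemma Fseq_vecR_ge0 C (j : nat) : 0 <= Fseq (vecR R C) j.
Proof. by apply: Fseq_ge0; exact: vecR_ge0. Qed.

Lemma Fseq_nonincr X : (forall b, 0 <= X b) ->
  {homo Fseq X : i j / (i <= j)%N >-> j <= i}.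
Proof.
move=> X0 i j ij; apply: ler_sum => b _.
apply: ler_wpM2l; first exact: mulr_ge0.
by rewrite lef_pV2 ?posrE ?exprn_gt0 // lerXn2r ?nnegrE // ler_nat.
Qed.

Lemma Fseq_le X (j : nat) : (forall b, X b <= 1) ->
  Fseq X j <= (j.+2%:R / j.+1%:R) ^+ k.
Proof.
move=> X1; rewrite -[j.+2%:R]natr1 mulrDl divff ?pnatr_eq0 // mul1r exprDn.
apply: ler_sum => b _; rewrite expr1n mul1r exprVn -[leRHS]mulr_natl.
by rewrite ler_wpM2r ?invr_ge0 ?exprn_ge0 // ler_piMr.
Qed.

Lemma prod_Fseq_le X (n : nat) : (forall b, 0 <= X b <= 1) ->
  \prod_(0 <= j < n) Fseq X j <= n.+1%:R ^+ k.
Proof.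
move=> X01; have X0 b : 0 <= X b by case/andP: (X01 b).
elim: n => [|n IH]; first by rewrite big_geq // expr1n.
have -> : n.+2%:R ^+ k = n.+1%:R ^+ k * (n.+2%:R / n.+1%:R) ^+ k :> R.
  by rewrite -exprMn mulrC divfK // pnatr_eq0.
rewrite big_nat_recr //= ler_pM ?prodr_ge0 // => [j _||]; try exact: Fseq_ge0.
by apply: Fseq_le => b; case/andP: (X01 b).
Qed.

End RecordRates.

Section ClosedForm.
Variables (R : realType) (k : nat) (C : 'I_k.+1 -> bool).

Local Notation F := (Fseq (vecR R C)).
Local Notation F' := (Fseq (vecR R (compl C))).

Lemma record_polyS (n : nat) :
  record_poly R C n.+1 = n.+1%:R ^+ k *: ((F' n)%:P + F n *: 'X).
Proof.
rewrite /Fseq /Fj rmorph_sum scaler_suml -big_split scaler_sumr /=.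
apply: eq_bigr => b _; have bk : (b <= k)%N by rewrite -ltnS.
have split_pow : n.+1%:R ^+ k * ('C(k, b)%:R / n.+1%:R ^+ b)
    = ('C(k, b) * n.+1 ^ (k - b))%:R :> R.
  rewrite -{1}(subnK bk) exprD natrM natrX; field.
  by rewrite expf_neq0 // nat1r pnatr_eq0.
rewrite -scaler_nat -split_pow /vecR /compl; case: (C b) => /=.
  by rewrite mulr0 mul0r polyC0 add0r mulr1 scalerA.
by rewrite mulr0 mul0r scale0r addr0 mulr1 alg_polyC -mul_polyC -polyCM.
Qed.

Lemma weight_polyS_prod (n : nat) : weight_poly R C n.+1 =
  n`!%:R ^+ k *: ('X^(C ord_max) * \prod_(0 <= j < n) ((F' j)%:P + F j *: 'X)).
Proof.
rewrite weight_polyE big_nat_recl //= record_poly0 scalerAr; congr (_ * _).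
elim: n => [|n IH]; first by rewrite !big_geq // fact0 expr1n scale1r.
rewrite !big_nat_recr //= IH record_polyS -scalerAl -scalerAr scalerA.
by rewrite factS natrM exprMn mulrC.
Qed.

Lemma OCmaxE (n q : nat) : (q <= n)%N ->
  OCmax R n.+1 C (q + C ord_max) = n`!%:R ^+ k * prod_linear_bound F F' n q.
Proof.
move=> qn; rewrite /OCmax -addSn addnK /= ltnS qn HnX_sum big_add1 subSS.
by rewrite /prod_linear_bound mulrA [X in _ = X * _]mulrA [_ * _ / _]mulrAC.
Qed.

Lemma OCmax_ge0 (n a : nat) : 0 <= OCmax R n.+1 C a.
Proof.
rewrite /OCmax; case: ifP => // _; rewrite HnX_sum big_add1.
rewrite !mulr_ge0 ?exprn_ge0 ?sumr_ge0 // => [j _|]; first exact: Fseq_vecR_ge0.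
by apply: prodr_ge0 => j _; exact: Fseq_vecR_ge0.
Qed.

Lemma OC_le_OCmax (n m : nat) : (OC n.+1 C m)%:R <= OCmax R n.+1 C m.
Proof.
rewrite -coef_weight_poly weight_polyS_prod coefZ coefXnM.
case: ltnP => [_|cm]; first by rewrite mulr0 OCmax_ge0.
have [mn|nm] := leqP (m - C ord_max) n; last first.
  rewrite nth_default ?mulr0 ?OCmax_ge0 //.
  exact: leq_trans (size_prod_linear_leq _ _ _) nm.
rewrite -{2}(subnK cm) OCmaxE // ler_wpM2l ?exprn_ge0 //.
apply: coef_prod_linear_le => [j|j|]; try exact: Fseq_vecR_ge0.
by apply: Fseq_nonincr; exact: vecR_ge0.
Qed.

Lemma sum_OCmax (n : nat) : \sum_(0 <= m < n.+2) OCmax R n.+1 C m =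
  n`!%:R ^+ k * \sum_(0 <= q < n.+1) prod_linear_bound F F' n q.
Proof.
transitivity (\sum_(0 <= q < n.+1) OCmax R n.+1 C (q + C ord_max)); last first.
  by rewrite mulr_sumr; apply: eq_big_nat => q /= qn; rewrite OCmaxE.
case c_max: (C ord_max).
  rewrite big_nat_recl // {1}/OCmax c_max add0r.
  by apply: eq_bigr => q _; rewrite addn1.
rewrite big_nat_recr //= [X in _ + X]/OCmax c_max subn0 ltnn addr0.
by apply: eq_bigr => q _; rewrite addn0.
Qed.

End ClosedForm.

(** * Logarithm and Euler's constant *)

Section LnBounds.
Variable R : realType.
Implicit Types x y t : R.

Lemma is_derive_ge0_le (f df : R -> R) (a b : R) : a <= b ->
  (forall x, a <= x <= b -> is_derive x 1 f (df x)) ->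
  (forall x, a <= x <= b -> 0 <= df x) -> f a <= f b.
Proof.
move=> ab f_df df0; have in_ab x : x \in `]a, b[ -> a <= x <= b.
  by rewrite in_itv /= => /andP[/ltW-> /ltW->].
apply: (@ger0_derive1_le_cc _ f a b) => //.
- by move=> x /in_ab xab; apply: ex_derive; exact: f_df.
- move=> x /in_ab xab; have f_dfx := f_df x xab.
  by rewrite derive1E derive_val df0.
- apply: derivable_within_continuous => x; rewrite in_itv /= => xab.
  by apply: ex_derive; exact: f_df.
- by rewrite in_itv /= lexx ab.
- by rewrite in_itv /= lexx ab.
Qed.

Lemma is_derive_ln_comp (f : R -> R) x df : 0 < f x -> is_derive x 1 f df ->
  is_derive x 1 (@ln R \o f) (df / f x).
Proof.
move=> fx0 f_df; rewrite mulrC.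
exact: (is_derive1_comp (is_derive1_ln fx0) f_df).
Qed.

Lemma ln_mulr2n_le_subV y : 1 <= y -> ln y *+ 2 <= y - y^-1.
Proof.
move=> y1; rewrite -subr_ge0.
have := @is_derive_ge0_le (fun x => x - x^-1 - ln x *+ 2)
  (fun x => (1 - x^-1) ^+ 2) 1 y y1.
rewrite invr1 ln1 mul0rn !subrr; apply => x /andP[x1 _]; last exact: sqr_ge0.
have x0 : 0 < x by apply: lt_le_trans x1.
have dV := is_deriveV (lt0r_neq0 x0) (is_derive_id x 1).
have dln := is_derive1_ln x0.
apply: is_derive_eq; rewrite [_%:A]mulr1.
by field; rewrite gt_eqF.
Qed.

(* The Taylor polynomial of [ln ((1 + x) / (1 - x))], which is [2 atanh x]. *)
Definition atanh_poly (n : nat) : {poly R} :=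
  \sum_(0 <= i < n) (2 / i.*2.+1%:R) *: 'X^(i.*2.+1).

Lemma horner_atanh_poly n x :
  (atanh_poly n).[x] = 2 * \sum_(0 <= i < n) x ^+ i.*2.+1 / i.*2.+1%:R.
Proof.
rewrite horner_sum mulr_sumr; apply: eq_bigr => i _.
by rewrite hornerZ hornerXn mulrAC mulrA.
Qed.

Lemma mul_horner_deriv_atanh_poly n x :
  (1 - x ^+ 2) * (atanh_poly n)^`().[x] = 2 * (1 - x ^+ n.*2).
Proof.
have -> : (atanh_poly n)^`().[x] = 2 * \sum_(i < n) (x ^+ 2) ^+ i.
  rewrite raddf_sum horner_sum big_mkord mulr_sumr; apply: eq_bigr => i _ /=.
  rewrite derivZ derivXn hornerZ hornerMn hornerXn /= -exprM mul2n -mulr_natr.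
  by field; rewrite nat1r pnatr_eq0.
by have := subrX1 (x ^+ 2) n; rewrite -exprM mul2n; lra.
Qed.

Lemma is_derive_ln1D_ln1B x : -1 < x < 1 ->
  is_derive x 1 (fun x => ln (1 + x) - ln (1 - x)) (2 / (1 - x ^+ 2)).
Proof.
move=> /andP[xN1 x1].
have dD : is_derive x 1 (@ln R \o +%R 1) (1 / (1 + x)).
  apply: is_derive_ln_comp; first lra.
  by rewrite -[X in is_derive _ _ _ X]add0r; apply: is_deriveD.
have dB : is_derive x 1 (@ln R \o (fun x => 1 - x)) (- 1 / (1 - x)).
  apply: is_derive_ln_comp; first lra.
  by rewrite -[X in is_derive _ _ _ X]sub0r; apply: is_deriveB.
apply: (is_derive_eq (is_deriveB dD dB)).
by field; do ?[apply/andP; split]; apply: lt0r_neq0; nra.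
Qed.

Lemma ln_atanh_ge t (n : nat) : 0 <= t < 1 ->
  2 * \sum_(0 <= i < n) t ^+ i.*2.+1 / i.*2.+1%:R <= ln ((1 + t) / (1 - t)).
Proof.
move=> /andP[t0 t1]; rewrite ln_div ?posrE; [|lra|lra].
have at0 : (atanh_poly n).[0] = 0.
  by rewrite horner_atanh_poly big1 ?mulr0 // => i _; rewrite expr0n mul0r.
rewrite -horner_atanh_poly -subr_ge0.
have := @is_derive_ge0_le
  (fun x => ln (1 + x) - ln (1 - x) - (atanh_poly n).[x])
  (fun x => 2 / (1 - x ^+ 2) - (atanh_poly n)^`().[x]) 0 t t0.
rewrite addr0 subr0 subrr at0 subr0; apply => x /andP[x0 xt].
  have x_bounds : -1 < x < 1 by lra.
  exact: is_deriveB (is_derive_ln1D_ln1B x_bounds) (is_derive_poly _ x).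
have x2_lt1 : 0 < 1 - x ^+ 2 by nra.
rewrite subr_ge0 ler_pdivlMr // mulrC mul_horner_deriv_atanh_poly.
by rewrite ler_piMr // gerBl exprn_ge0.
Qed.

End LnBounds.

Section EulerGamma.
Local Open Scope classical_set_scope.
Local Open Scope ring_scope.
Variable R : realType.
Implicit Type N : nat.

Definition harmonic_number N : R := \sum_(1 <= j < N.+1) j%:R^-1.

(* The first two corrections of the Euler-Maclaurin expansion of
   [harmonic_number N - ln N] bracket its limit. *)
Definition gamma_lower N : R := harmonic_number N - ln N%:R - (2 * N%:R)^-1.
Definition gamma_upper N : R := gamma_lower N + (12 * N%:R ^+ 2)^-1.

Lemma ln_succ_ratio_le (x : R) : 0 < x ->
  ln ((x + 1) / x) <= (2 * x)^-1 + (2 * (x + 1))^-1.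
Proof.
move=> x0; have /ln_mulr2n_le_subV : 1 <= (x + 1) / x.
  by rewrite ler_pdivlMr // mul1r lerDl.
have -> : (x + 1) / x - ((x + 1) / x)^-1 = ((2 * x)^-1 + (2 * (x + 1))^-1) *+ 2.
  by field; do ?[apply/andP; split]; apply: lt0r_neq0; lra.
by rewrite lerMn2r.
Qed.

Lemma ln_succ_ratio_ge (x : R) : 0 < x ->
  (2 * x)^-1 + (2 * (x + 1))^-1 - ((12 * x ^+ 2)^-1 - (12 * (x + 1) ^+ 2)^-1)
  <= ln ((x + 1) / x).
Proof.
move=> x0; pose t := (2 * x + 1)^-1.
have t0 : 0 < t by rewrite invr_gt0; lra.
have t1 : t < 1 by rewrite invf_lt1; lra.
have -> : (x + 1) / x = (1 + t) / (1 - t).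
  by rewrite /t; field; do ?[apply/andP; split]; apply: lt0r_neq0; lra.
have t_bounds : 0 <= t < 1 by rewrite ltW.
apply: le_trans (ln_atanh_ge 2 t_bounds).
rewrite /index_iota /= !big_cons big_nil !(doubleS, double0) -subr_ge0.
rewrite [leRHS](_ : _ = (2 * x ^+ 2 + 2 * x + 1)
   / (12 * x ^+ 2 * (x + 1) ^+ 2 * (2 * x + 1) ^+ 3)); last first.
  by rewrite /t; field; do ?[apply/andP; split]; apply: lt0r_neq0; lra.
by apply: divr_ge0; [nra | rewrite !mulr_ge0 ?exprn_ge0 //; lra].
Qed.

Lemma harmonic_numberS N :
  harmonic_number N.+1 = harmonic_number N + N.+1%:R^-1.
Proof. by rewrite /harmonic_number big_nat_recr. Qed.

Lemma ln_natS N : (0 < N)%N ->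
  ln (N.+1%:R : R) = ln N%:R + ln ((N%:R + 1) / N%:R).
Proof.
move=> N0; have N_gt0 : (0 : R) < N%:R by rewrite ltr0n.
by rewrite natr1 ln_div ?posrE // addrC subrK.
Qed.

Lemma gamma_lower_nondecreasing : nondecreasing_seq (fun N => gamma_lower N.+1).
Proof.
apply/nondecreasing_seqP => N.
rewrite /gamma_lower (harmonic_numberS N.+1) (ln_natS (ltn0Sn N)) -(natr1 N.+1).
move: N.+1%:R (ltr0Sn R N) => x x0; have := ln_succ_ratio_le x0.
have -> : (x + 1)^-1 = 2 * (2 * (x + 1))^-1 by field; apply: lt0r_neq0; lra.
by lra.
Qed.

Lemma gamma_upper_nonincreasing : nonincreasing_seq (fun N => gamma_upper N.+1).
Proof.
apply/nonincreasing_seqP => N.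
rewrite /gamma_upper /gamma_lower (harmonic_numberS N.+1) (ln_natS (ltn0Sn N)).
rewrite -(natr1 N.+1).
move: N.+1%:R (ltr0Sn R N) => x x0; have := ln_succ_ratio_ge x0.
have -> : (x + 1)^-1 = 2 * (2 * (x + 1))^-1 by field; apply: lt0r_neq0; lra.
by lra.
Qed.

Lemma cvg0_of_le_harmonic (u : nat -> R) :
  (forall N, 0 <= u N <= N.+1%:R^-1) -> u N @[N --> \oo] --> (0 : R).
Proof.
move=> u_le; apply: (@squeeze_cvgr _ _ _ _ (cst 0) (@harmonic R)).
- exact: nearW.
- exact: cvg_cst.
- exact: cvg_harmonic.
Qed.

Lemma gamma_bracket_cvg :
  [/\ limn (fun N => gamma_upper N.+1) = limn (fun N => gamma_lower N.+1),
      cvgn (fun N => gamma_lower N.+1) & cvgn (fun N => gamma_upper N.+1)].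
Proof.
apply: adjacent_seq gamma_lower_nondecreasing gamma_upper_nonincreasing _.
apply: cvg0_of_le_harmonic => N; rewrite !fctE /gamma_upper addrC addKr.
rewrite invr_ge0 mulr_ge0 ?exprn_ge0 //= lef_pV2 ?posrE ?mulr_gt0 //.
by rewrite -natrX -natrM ler_nat; nia.
Qed.

Lemma gamma_lower_lim : limn (fun N => gamma_lower N.+1) = euler_gamma R.
Proof.
have [_ lower_cvg _] := gamma_bracket_cvg.
apply/esym/cvg_lim => //; rewrite -cvg_shiftS.
have half_cvg : (2 * N.+1%:R)^-1 @[N --> \oo] --> (0 : R).
  apply: cvg0_of_le_harmonic => N; rewrite invr_ge0 mulr_ge0 //=.
  by rewrite lef_pV2 ?posrE ?mulr_gt0 // ler_peMl // ler1n.
have gap_cvg : gamma_lower N.+1 + (2 * N.+1%:R)^-1 @[N --> \oo]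
    --> limn (fun N => gamma_lower N.+1) + 0 by exact: cvgD.
rewrite addr0 in gap_cvg; apply: cvg_trans gap_cvg.
by apply: near_eq_cvg; apply: nearW => N; rewrite subrK.
Qed.

Lemma gamma_lower_le N : (0 < N)%N -> gamma_lower N <= euler_gamma R.
Proof.
case: N => // N _; have [_ lower_cvg _] := gamma_bracket_cvg.
rewrite -gamma_lower_lim.
exact: (nondecreasing_cvgn_le gamma_lower_nondecreasing lower_cvg N).
Qed.

Lemma gamma_upper_ge N : (0 < N)%N -> euler_gamma R <= gamma_upper N.
Proof.
case: N => // N _; have [lim_eq _ upper_cvg] := gamma_bracket_cvg.
rewrite -gamma_lower_lim -lim_eq.
exact: (nonincreasing_cvgn_ge gamma_upper_nonincreasing upper_cvg N).
Qed.

Lemma euler_gamma_ge_half : 2^-1 <= euler_gamma R.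
Proof.
apply: le_trans (@gamma_lower_le 1 isT).
by rewrite /gamma_lower /harmonic_number big_nat1 ln1; lra.
Qed.

Lemma harmonic_number_sub_ln_succ_le N :
  harmonic_number N - ln N.+1%:R <= euler_gamma R.
Proof.
apply: le_trans (@gamma_lower_le N.+1 isT).
rewrite /gamma_lower harmonic_numberS.
move: N.+1%:R (ltr0Sn R N) => x x0.
have : (2 * x)^-1 <= x^-1 by rewrite lef_pV2 ?posrE ?mulr_gt0 // ler_peMl; lra.
by lra.
Qed.

(* [gamma >= 1/2] absorbs the correction [1 / (2 N)] into the factor
   [1 + 1 / N]. *)
Lemma harmonic_number_le N : (0 < N)%N ->
  harmonic_number N <= N.+1%:R / N%:R * (ln N%:R + euler_gamma R).
Proof.
move=> N0; have N_gt0 : (0 : R) < N%:R by rewrite ltr0n.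
have ln_N0 : (0 : R) <= ln N%:R by apply: ln_ge0; rewrite ler1n.
have half_le : N%:R^-1 * 2^-1 <= N%:R^-1 * (ln N%:R + euler_gamma R).
  rewrite ler_wpM2l ?invr_ge0 //.
  by have := euler_gamma_ge_half; lra.
have := gamma_lower_le N0; rewrite /gamma_lower invfM mulrC.
rewrite -(natr1 N) mulrDl divff ?gt_eqF // mulrDl mul1r.
by lra.
Qed.

Lemma expR_euler_gamma_le : expR (euler_gamma R) <= 17811%:R / 10000%:R.
Proof.
rewrite -[leRHS]lnK ?ler_expR ?posrE; last lra.
apply: le_trans (@gamma_upper_ge 8 isT) _.
have ln3_2 : ln (3 / 2 : R) = ln ((1 + 5^-1) / (1 - 5^-1)).
  by congr ln; apply: (canRL (mulfK _)); [apply: lt0r_neq0|]; lra.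
have ln339_271 : ln (339 / 271 : R) = ln ((1 + 34 / 305) / (1 - 34 / 305)).
  by congr ln; apply: (canRL (mulfK _)); [apply: lt0r_neq0|]; lra.
have fifth_bounds : 0 <= (5^-1 : R) < 1 by lra.
have ratio_bounds : 0 <= (34 / 305 : R) < 1 by lra.
have ln3_2_ge := ln_atanh_ge 4 fifth_bounds.
have ln339_271_ge := ln_atanh_ge 4 ratio_bounds.
rewrite /index_iota /= !big_cons big_nil !(doubleS, double0) -ln3_2 in ln3_2_ge.
rewrite /index_iota /= !big_cons big_nil !(doubleS, double0) -ln339_271
  in ln339_271_ge.
(* 8 * 1.7811 is just above (3/2)^6 * 339/271. *)
have : ln ((3 / 2) ^+ 6 * (339 / 271) / 8) <= ln (17811%:R / 10000%:R : R).
  by rewrite ler_ln ?posrE; lra.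
rewrite ln_div 1?lnM ?posrE; try lra; rewrite lnXn; last lra.
rewrite /gamma_upper /gamma_lower /harmonic_number /index_iota /=.
rewrite !big_cons big_nil.
by lra.
Qed.

End EulerGamma.

(** * Partial sums of [zeta 2] *)

Lemma sum_nat_double (V : nmodType) (F : nat -> V) (n : nat) :
  \sum_(0 <= k < n.*2) F k = \sum_(0 <= k < n) (F k.*2 + F k.*2.+1).
Proof.
elim: n => [|n IH]; first by rewrite !big_geq.
by rewrite doubleS !big_nat_recr //= IH addrA.
Qed.

Section InverseSquares.
Variable R : realType.
Implicit Types (x : R) (m n : nat).

Lemma sin_le x : 0 <= x -> sin x <= x.
Proof.
move=> x0; rewrite -subr_ge0.
have := @is_derive_ge0_le R (fun x => x - sin x) (fun x => 1 - cos x) 0 x x0.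
by rewrite sin0 subr0; apply => y _; rewrite subr_ge0 cos_le1.
Qed.

Lemma csc_sqr_half x : 0 < x < pi ->
  4 * sin x ^- 2 = sin (x / 2) ^- 2 + sin ((pi - x) / 2) ^- 2.
Proof.
move=> /andP[x0 xpi].
have s0 : 0 < sin (x / 2) by apply: sin_gt0_pi; lra.
have c0 : 0 < cos (x / 2) by apply: cos_gt0_pihalf; lra.
have -> : sin ((pi - x) / 2) = cos (x / 2).
  have -> : (pi - x) / 2 = - (x / 2) + pi / 2 by lra.
  by rewrite sinDpihalf cosN.
have -> : sin x = (cos (x / 2) * sin (x / 2)) *+ 2.
  by rewrite -sin_mulr2n; congr sin; lra.
set s := sin _ in s0 *; set c := cos _ in c0 *.
have -> : s ^- 2 + c ^- 2 = (c ^+ 2 + s ^+ 2) / (s ^+ 2 * c ^+ 2).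
  by field; rewrite !gt_eqF.
by rewrite cos2Dsin2; field; rewrite !gt_eqF.
Qed.

Definition odd_angle m k : R := k.*2.+1%:R * pi / (4 * m%:R).

Definition odd_csc_sqr_sum m : R := \sum_(0 <= k < m) sin (odd_angle m k) ^- 2.

Lemma odd_angle_bounds m k : (k < m)%N -> 0 < odd_angle m k < pi.
Proof.
move=> km; have p0 := pi_gt0 R.
have m0 : (0 : R) < m%:R by rewrite ltr0n (leq_ltn_trans _ km).
rewrite /odd_angle divr_gt0 ?mulr_gt0 //= ltr_pdivrMr ?mulr_gt0 // mulrC.
by rewrite ltr_pM2l // -natrM ltr_nat; lia.
Qed.

(* Halving the angles of [odd_csc_sqr_sum m] and their supplements gives the
   angles of [odd_csc_sqr_sum m.*2]. *)
Lemma odd_csc_sqr_sum_double m : odd_csc_sqr_sum m.*2 = 4 * odd_csc_sqr_sum m.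
Proof.
have [->|m0] := posnP m; first by rewrite /odd_csc_sqr_sum !big_geq // mulr0.
have m_neq0 : (m%:R : R) != 0 by rewrite pnatr_eq0 -lt0n.
have le_m : (m <= m.*2)%N by rewrite -addnn leq_addr.
rewrite /odd_csc_sqr_sum (big_cat_nat _ le_m) //= [X in _ + X]big_nat_rev /=.
rewrite -[X in \sum_(X <= _ < m.*2) _]add0n big_addn -[X in (X - m)%N]addnn.
rewrite addnK mulr_sumr -big_split /=.
apply: eq_big_nat => k /andP[_ km]; rewrite csc_sqr_half ?odd_angle_bounds //.
congr (sin _ ^- 2 + sin _ ^- 2); rewrite /odd_angle.
  by rewrite -[m.*2]muln2 natrM; field.
have -> : ((m + m.*2 - (k + m).+1).*2.+1)%:R = 4 * m%:R - k.*2.+1%:R :> R.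
  by rewrite -natrM -natrB; [congr _%:R|]; lia.
by rewrite -[m.*2]muln2 natrM; field.
Qed.

Lemma odd_csc_sqr_sum_exp2 a : odd_csc_sqr_sum (2 ^ a) = 2 * (2 ^ a)%:R ^+ 2.
Proof.
elim: a => [|a IH]; last first.
  by rewrite expnS mul2n odd_csc_sqr_sum_double IH -mul2n natrM; ring.
rewrite /odd_csc_sqr_sum big_nat1 /odd_angle mul1r mulr1.
have /csc_sqr_half : 0 < (pi : R) / 2 < pi by have := pi_gt0 R; lra.
have -> : (pi - pi / 2) / 2 = pi / 4 :> R by lra.
have -> : pi / 2 / 2 = pi / 4 :> R by lra.
by rewrite sin_pihalf; lra.
Qed.

Lemma sum_inv_sqr_odd_le m :
  \sum_(0 <= k < m) k.*2.+1%:R ^- 2 <= pi ^+ 2 / 8 :> R.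
Proof.
set M := (2 ^ m)%N; have mM : (m <= M)%N by exact/ltnW/ltn_expl.
have M0 : (0 : R) < M%:R by rewrite ltr0n expn_gt0.
have pi0 := pi_gt0 R.
apply: (@le_trans _ _ (\sum_(0 <= k < M) k.*2.+1%:R ^- 2)).
  rewrite [leRHS](big_cat_nat _ mM) //= lerDl; apply: sumr_ge0 => k _.
  by rewrite invr_ge0 exprn_ge0.
rewrite -(@ler_pM2l R ((4 * M%:R / pi) ^+ 2)) ?exprn_gt0 ?divr_gt0 ?mulr_gt0 //.
rewrite [leRHS](_ : _ = odd_csc_sqr_sum M); last first.
  rewrite odd_csc_sqr_sum_exp2 -/M; move: pi pi0 => p p0.
  by field; exact: lt0r_neq0.
rewrite mulr_sumr; apply: ler_sum_nat => k /andP[_ kM].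
have angle_bounds := odd_angle_bounds kM.
have /andP[angle0 _] := angle_bounds.
have sin0 := sin_gt0_pi angle_bounds.
rewrite [leLHS](_ : _ = odd_angle M k ^- 2); last first.
  rewrite /odd_angle; move: pi pi0 => p p0; field.
  by rewrite (gt_eqF M0) (gt_eqF p0) nat1r pnatr_eq0.
rewrite lef_pV2 ?posrE ?exprn_gt0 //.
by apply: lerXn2r; rewrite ?nnegrE ?sin_le // ltW.
Qed.

(* The even terms of the sum up to [2 N] contribute a quarter of the sum up
   to [N]. *)
Lemma sum_inv_sqr_le n : \sum_(1 <= j < n) j%:R ^- 2 <= pi ^+ 2 / 6 :> R.
Proof.
rewrite big_add1; set N := n.-1.
set s := \sum_(0 <= j < N) _.
have s_le : s <= \sum_(0 <= j < N.*2) j.+1%:R ^- 2.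
  rewrite [leRHS](big_cat_nat _ (_ : N <= N.*2)%N) -?addnn ?leq_addr //=.
  by rewrite lerDl sumr_ge0.
have even_part : \sum_(0 <= k < N) k.*2.+2%:R ^- 2 = s / 4.
  rewrite mulr_suml; apply: eq_bigr => k _.
  by rewrite -doubleS -muln2 natrM; field; rewrite nat1r pnatr_eq0.
move: s_le (sum_inv_sqr_odd_le N).
by rewrite sum_nat_double big_split /= even_part; lra.
Qed.

Lemma sum_inv_exprn_le n (b : nat) : (2 <= b)%N ->
  \sum_(1 <= j < n) j%:R ^- b <= pi ^+ 2 / 6 :> R.
Proof.
move=> b2; apply: le_trans (sum_inv_sqr_le n).
apply: ler_sum_nat => j /andP[j1 _].
rewrite lef_pV2 ?posrE ?exprn_gt0 ?ltr0n //.
by apply: ler_weXn2l => //; rewrite ler1n.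
Qed.

End InverseSquares.

(** * The ratio bounds *)

Lemma sum_exp_coeff_le_expR (R : realType) (n : nat) (x : R) : 0 <= x ->
  \sum_(0 <= q < n) x ^+ q / q`!%:R <= expR x.
Proof.
move=> x0; apply: (nondecreasing_cvgn_le _ (is_cvg_series_exp_coeff x) n).
by apply: nondecreasing_series => q _ _; exact: exp_coeff_ge0.
Qed.

(* Bernoulli's inequality [(1 - 1 / (N + 1)) ^ q >= 1 - q / (N + 1)], cleared of
   denominators. *)
Lemma succ_ratio_exprn_le (R : realFieldType) (N q : nat) : (0 < N)%N ->
  (N.+1%:R / N%:R) ^+ q * (N.+1 - q)%:R <= N.+1%:R :> R.
Proof.
move=> N0; elim: q => [|q IH]; first by rewrite expr0 mul1r subn0.
apply: le_trans IH; rewrite exprSr -mulrA ler_wpM2l ?exprn_ge0 ?divr_ge0 //.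
by rewrite mulrAC ler_pdivrMr ?ltr0n // -!natrM ler_nat; nia.
Qed.

Section Lambda.
Variables (R : realType) (k N : nat) (C : 'I_k.+1 -> bool).
Hypotheses (k_gt0 : (0 < k)%N) (N_gt0 : (0 < N)%N).

Definition inv_power_sum_bound (b : nat) : R :=
  match b with
  | 0 => N%:R
  | 1 => ln N%:R + euler_gamma R
  | _ => pi ^+ 2 / 6%:R
  end.

Lemma inv_power_sum_bound_ge0 b : 0 <= inv_power_sum_bound b.
Proof.
case: b => [|[|b]] //=; last by rewrite divr_ge0 ?exprn_ge0 ?pi_ge0.
rewrite addr_ge0 ?ln_ge0 ?ler1n //.
by rewrite (le_trans _ (euler_gamma_ge_half R)) ?invr_ge0.
Qed.

Lemma inv_power_sum_le b :
  \sum_(1 <= j < N.+1) (j%:R : R) ^- b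
  <= N.+1%:R / N%:R * inv_power_sum_bound b.
Proof.
have le_ratio (x : R) : 0 <= x -> x <= N.+1%:R / N%:R * x.
  by move=> x0; rewrite ler_peMl // ler_pdivlMr ?ltr0n // mul1r ler_nat.
case: b => [|[|b]]; last 1 first.
- exact: le_trans (sum_inv_exprn_le R N.+1 (isT : 2 <= b.+2)%N)
    (le_ratio _ (inv_power_sum_bound_ge0 b.+2)).
- rewrite (eq_bigr (fun=> 1)) => [|j _]; last by rewrite expr0 invr1.
  by rewrite sumr_const_nat subn1 le_ratio.
- exact: harmonic_number_le.
Qed.

Lemma lambdaCE : lambdaC R N.+1 C =
  \sum_(b < k.+1) vecR R C b * 'C(k, b)%:R * inv_power_sum_bound b.
Proof.
rewrite (eq_bigr (fun b : 'I_k.+1 => vecR R C (inord b) * 'C(k, b)%:R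
  * inv_power_sum_bound b)) => [|b _]; last by rewrite inord_val.
rewrite -(big_mkord xpredT
  (fun b => vecR R C (inord b) * 'C(k, b)%:R * inv_power_sum_bound b)).
rewrite big_ltn // big_ltn // addrA /lambdaC bin0 bin1 mulr1.
congr (_ + _); rewrite mulr_sumr; apply: eq_big_nat => -[|[|b]] //= _.
by rewrite mulrC.
Qed.

Lemma lambdaC_ge0 : 0 <= lambdaC R N.+1 C.
Proof.
rewrite lambdaCE; apply: sumr_ge0 => b _.
by rewrite !mulr_ge0 ?vecR_ge0 ?inv_power_sum_bound_ge0.
Qed.

Lemma HnX_le_lambdaC : HnX N.+1 (vecR R C) <= N.+1%:R / N%:R * lambdaC R N.+1 C.
Proof.
rewrite lambdaCE mulr_sumr; apply: ler_sum => b _.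
by rewrite [leRHS]mulrCA ler_wpM2l ?inv_power_sum_le // mulr_ge0 ?vecR_ge0.
Qed.

Lemma prod_linear_bound_le (q : nat) : (q <= N)%N ->
  prod_linear_bound (Fseq (vecR R C)) (Fseq (vecR R (compl C))) N q
  <= N.+1%:R ^+ k * (lambdaC R N.+1 C ^+ q / q`!%:R).
Proof.
move=> qN; rewrite /prod_linear_bound -HnX_sum mulrAC mulrA.
rewrite ler_wpM2r ?invr_ge0 //.
set r : R := N.+1%:R / N%:R; set lambda := lambdaC R N.+1 C.
have r0 : 0 <= r by rewrite divr_ge0.
have HnX_ge0 : 0 <= HnX N.+1 (vecR R C).
  by rewrite HnX_sum sumr_ge0 // => j _; exact: Fseq_vecR_ge0.
have prod_ge0 : 0 <= \prod_(0 <= j < N - q) Fseq (vecR R (compl C)) j.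
  by rewrite prodr_ge0 // => j _; exact: Fseq_vecR_ge0.
have HnX_exp_le : HnX N.+1 (vecR R C) ^+ q <= (r * lambda) ^+ q.
  by rewrite lerXn2r ?nnegrE ?mulr_ge0 ?lambdaC_ge0 ?HnX_le_lambdaC.
have prod_le := prod_Fseq_le (N - q) (vecR_bounds R (compl C)).
apply: le_trans (ler_pM (exprn_ge0 q HnX_ge0) prod_ge0 HnX_exp_le prod_le) _.
rewrite exprMn mulrAC ler_wpM2r ?exprn_ge0 ?lambdaC_ge0 //.
rewrite -subSn // -(prednK k_gt0) !exprS mulrA ler_pM ?mulr_ge0 ?exprn_ge0 //.
  exact: succ_ratio_exprn_le.
by rewrite lerXn2r ?nnegrE // ler_nat leq_subr.
Qed.

End Lambda.

Lemma stirling1u_small (n m : nat) : (n < m)%N -> stirling1u n m = 0%N.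
Proof.
by elim: n m => [|n IH] [|m] //= nm; rewrite !IH ?muln0 // ltnW.
Qed.

Lemma sum_stirling1u (n : nat) : (\sum_(0 <= m < n.+1) stirling1u n m = n`!)%N.
Proof.
elim: n => [|n IH]; first by rewrite big_nat1.
rewrite big_nat_recl //= add0n big_split /= IH -big_distrr /= factS mulSn addnC.
congr addn; case: n IH => [|n] IH; first by rewrite !mul0n.
rewrite -IH; congr muln; rewrite big_nat_recr // [in RHS]big_nat_recl //.
by rewrite (@stirling1u_small n.+1 n.+2) //= addn0 add0n.
Qed.

Section Ratios.
Variables (R : realType) (N : nat).
Hypothesis N_gt0 : (0 < N)%N.

Lemma sum_OCmax_ratio_le (k : nat) (C D : 'I_k.+1 -> bool) : (0 < k)%N ->
  (\sum_(0 <= m < N.+2) OCmax R N.+1 C m)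
    / (\sum_(0 <= m < N.+2) (OC N.+1 D m)%:R)
  <= expR (lambdaC R N.+1 C).
Proof.
move=> k_gt0; rewrite -natr_sum sum_OC sum_OCmax natrX.
rewrite ler_pdivrMr ?exprn_gt0 ?ltr0n ?fact_gt0 //.
rewrite factS mulnC natrM exprMn mulrCA ler_wpM2l ?exprn_ge0 // mulrC.
have exp_le := sum_exp_coeff_le_expR N.+1 (lambdaC_ge0 R C k_gt0 N_gt0).
apply: le_trans (ler_wpM2l _ exp_le); last exact: exprn_ge0.
rewrite mulr_sumr; apply: ler_sum_nat => q /= qN.
exact: prod_linear_bound_le.
Qed.

Lemma sum_sumax_ratio_le :
  (\sum_(0 <= m < N.+2) sumax R N.+1 m)
    / (\sum_(0 <= m < N.+2) (stirling1u N.+1 m)%:R)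
  <= expR (harmonic_number R N) / N.+1%:R.
Proof.
rewrite -natr_sum sum_stirling1u factS natrM.
have fact_pos : (0 : R) < N`!%:R by rewrite ltr0n fact_gt0.
rewrite ler_pdivrMr ?mulr_gt0 // mulrA divfK ?pnatr_eq0 // mulrC.
have harmonic0 : 0 <= harmonic_number R N by rewrite sumr_ge0.
have exp_le := sum_exp_coeff_le_expR N.+1 harmonic0.
apply: le_trans (ler_wpM2l (ltW fact_pos) exp_le).
rewrite big_nat_recl // {1}/sumax add0r mulr_sumr.
apply: ler_sum_nat => q /= qN.
by rewrite /sumax /= qN /= mulrA mulrAC.
Qed.

End Ratios.

Theorem theorem5p3 (R : realType) (k n : nat) (C : 'I_k.+1 -> bool) :
  (1 <= k)%N -> (2 <= n)%N ->
  (* (i) *)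
  (forall m : nat, (m <= n)%N ->
     ((OC n C m)%:R : R) <= OCmax R n (compl C) (n - m)) /\
  (* (ii) *)
  ((\sum_(0 <= m < n.+1) OCmax R n C m)
     / (\sum_(0 <= m < n.+1) (OC n C m)%:R) <= expR (lambdaC R n C)) /\
  (* (iii) *)
  ((\sum_(0 <= m < n.+1) OCmax R n (compl C) m)
     / (\sum_(0 <= m < n.+1) (OC n C m)%:R) <= expR (lambdaC R n (compl C))) /\
  (* (iv) *)
  ((\sum_(0 <= m < n.+1) sumax R n m)
     / (\sum_(0 <= m < n.+1) (stirling1u n m)%:R)
   <= (n.-1)%:R / n%:R
        * expR (\sum_(2 <= j < n.+1) ((j.-1)%:R : R)^-1 - ln ((n.-1)%:R : R))
   /\ (n.-1)%:R / n%:R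
        * expR (\sum_(2 <= j < n.+1) ((j.-1)%:R : R)^-1 - ln ((n.-1)%:R : R))
      <= expR (euler_gamma R)
   /\ expR (euler_gamma R) <= 17811%:R / 10000%:R).
Proof.
case: n => // N k_gt0 N_gt0.
have middleE : N%:R / N.+1%:R
    * expR (\sum_(2 <= j < N.+2) ((j.-1)%:R : R)^-1 - ln (N%:R : R))
    = expR (harmonic_number R N) / N.+1%:R.
  rewrite big_add1 expRB lnK ?posrE ?ltr0n //= -/(harmonic_number R N).
  by rewrite mulrC mulrA divfK // pnatr_eq0 -lt0n.
split; first by move=> m mn; rewrite (OC_compl C mn) OC_le_OCmax.
split; first exact: sum_OCmax_ratio_le.
split; first exact: sum_OCmax_ratio_le.
rewrite middleE; split; first exact: sum_sumax_ratio_le.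
split; last exact: expR_euler_gamma_le.
rewrite -[X in _ / X]lnK ?posrE // -expRB ler_expR.
exact: harmonic_number_sub_ln_succ_le.
Qed.
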